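(* Let $\boldsymbol X\in\mathbb R^{m\times n_x}$ be the concatenation of $\boldsymbol X_p\in\mathbb R^{m\times n_p}$, $p=1,\dots,P$, with $\sum_{p=1}^Pn_p=n_x$, let $\boldsymbol Y\in\mathbb R^{m\times n_y}$, and let $\tilde{\boldsymbol Y}=\boldsymbol Y+\boldsymbol E$ where the entries of $\boldsymbol E\in\mathbb R^{m\times n_y}$ are drawn from $\mathcal N(0,\sigma^2)$. Let $\tilde{\boldsymbol X}_a^y=[\tilde{\boldsymbol Y},\boldsymbol X]\in\mathbb R^{m\times(n_x+n_y)}$ be the augmented matrix, let $\boldsymbol W=\boldsymbol K_{\tilde{\boldsymbol Y},\tilde{\boldsymbol Y}}$, let $\boldsymbol W_k^\dagger$ be the Moore–Penrose inverse of the best rank-$k$ approximation of $\boldsymbol W$ ($1\le k\le n_y$), and let $$\widehat{\boldsymbol H}_{\boldsymbol X,\boldsymbol X|\tilde{\boldsymbol Y}}=\boldsymbol K_{\boldsymbol X,\tilde{\boldsymbol Y}}\,\boldsymbol W_k^\dagger\,\boldsymbol K_{\boldsymbol X,\tilde{\boldsymbol Y}}^T.$$ Then $$\|\widehat{\boldsymbol H}_{\boldsymbol X,\boldsymbol X|\tilde{\boldsymbol Y}}-\boldsymbol K_{\boldsymbol X,\boldsymbol X}\|_2\le\mathrm{Cond}(\boldsymbol K_{\tilde{\boldsymbol X}_a^y,\tilde{\boldsymbol X}_a^y})\left(\frac{|\mathrm{MMD}(\boldsymbol X,\tilde{\boldsymbol Y})|}{n_x+n_y}+1\right)+2n_x,$$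 and, alternatively, $$\|\widehat{\boldsymbol H}_{\boldsymbol X,\boldsymbol X|\tilde{\boldsymbol Y}}-\boldsymbol K_{\boldsymbol X,\boldsymbol X}\|_F\le\sqrt{n_x+n_y-k}\;\mathrm{Cond}(\boldsymbol K_{\tilde{\boldsymbol X}_a^y,\tilde{\boldsymbol X}_a^y})\left(\frac{|\mathrm{MMD}(\boldsymbol X,\tilde{\boldsymbol Y})|}{n_x+n_y}+1\right)+2k^{1/4}n_x\sqrt{1+\frac{n_y}{n_x}}.$$
   Context: Columns of matrices are data points; $n_x,n_y\ge2$. Gaussian kernel: $k(\boldsymbol x,\boldsymbol y)=\exp(-\gamma\|\boldsymbol x-\boldsymbol y\|_2^2)$ with $\gamma>0$ (the kernel function $k(\cdot,\cdot)$ is distinct from the rank $k$). For matrices $\boldsymbol U,\boldsymbol V$ with $m$ rows and columns $\boldsymbol u_i,\boldsymbol v_j$, $\boldsymbol K_{\boldsymbol U,\boldsymbol V}$ is the matrix with $(i,j)$ entry $k(\boldsymbol u_i,\boldsymbol v_j)$. $\|\cdot\|_2$ is the spectral norm, $\|\cdot\|_F$ the Frobenius norm, and $\mathrm{Cond}(\cdot)$ is the condition number, i.e. the ratio of the largest to the smallest singular value ($+\infty$ if singular). For $\boldsymbol U\in\mathbb R^{m\times n}$ and $\boldsymbol V\in\mathbb R^{m\times n'}$, $$\mathrm{MMD}(\boldsymbol U,\boldsymbol V)=\frac{1}{n(n-1)}\sum_{i=1}^{n}\sum_{j\ne i}k(\boldsymbol u_i,\boldsymbol u_j)-\frac{2}{nn'}\sum_{i=1}^{n}\sum_{j=1}^{n'}k(\boldsymbol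 u_i,\boldsymbol v_j)+\frac{1}{n'(n'-1)}\sum_{i=1}^{n'}\sum_{j\neq i}k(\boldsymbol v_i,\boldsymbol v_j).$$ *)

(* Defs.v *)
From mathcomp Require Export all_boot all_order all_algebra.
From mathcomp Require Export all_classical all_reals all_analysis.

Set Implicit Arguments.
Unset Strict Implicit.
Unset Printing Implicit Defensive.

Import Order.TTheory GRing.Theory Num.Theory.

Local Open Scope classical_set_scope.
Local Open Scope ring_scope.

(* On column vectors ('cV[R]_m = 'M[R]_(m, 1)) this is the Euclidean norm. *)
Definition frobenius_norm (R : realType) (m n : nat) (A : 'M[R]_(m, n)) : R :=
  Num.sqrt (\sum_(i < m) \sum_(j < n) A i j ^+ 2).

(* Multiplicities are dropped: only the extreme singular values are used. *)
Definition singular_values (R : realType) (n : nat) (A : 'M[R]_n) : set R :=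
  [set Num.sqrt a | a in [set a | eigenvalue (A^T *m A) a]].

(* For n > 0 the set of singular values is finite and nonempty (A^T *m A is
   symmetric positive semidefinite), so sup and inf are a maximum and a
   minimum. *)
Definition max_singular_value (R : realType) (n : nat) (A : 'M[R]_n) : R :=
  sup (singular_values A).

Definition min_singular_value (R : realType) (n : nat) (A : 'M[R]_n) : R :=
  inf (singular_values A).

Definition spectral_norm (R : realType) (n : nat) (A : 'M[R]_n) : R :=
  max_singular_value A.

Definition cond (R : realType) (n : nat) (A : 'M[R]_n) : \bar R :=
  if A \in unitmx then (max_singular_value A / min_singular_value A)%:E
  else +oo%E.

(* The four Penrose equations, which determine B uniquely (real case). *)
Definition is_moore_penrose (R : realType) (m n : nat)
    (A : 'M[R]_(m, n)) (B : 'M[R]_(n, m)) : Prop :=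
  [/\ A *m B *m A = A,
      B *m A *m B = B,
      (A *m B)^T = A *m B
    & (B *m A)^T = B *m A].

(* A relation rather than a function: the minimizer is not unique when the
   k-th and (k+1)-st singular values of A coincide.  The minimizers for the
   Frobenius norm are exactly the k-truncated singular value decompositions of
   A; the spectral norm would admit further minimizers. *)
Definition is_best_rank_approx (R : realType) (m n : nat) (k : nat)
    (A B : 'M[R]_(m, n)) : Prop :=
  (\rank B <= k)%N /\
  forall C : 'M[R]_(m, n), (\rank C <= k)%N ->
    frobenius_norm (A - B) <= frobenius_norm (A - C).

Definition gaussian_kernel (R : realType) (gamma : R) (m : nat)
    (x y : 'cV[R]_m) : R :=
  expR (- gamma * frobenius_norm (x - y) ^+ 2).

Definition kernel_mx (R : realType) (gamma : R) (m n n' : nat)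
    (U : 'M[R]_(m, n)) (V : 'M[R]_(m, n')) : 'M[R]_(n, n') :=
  \matrix_(i < n, j < n') gaussian_kernel gamma (col i U) (col j V).

Definition MMD (R : realType) (gamma : R) (m n n' : nat)
    (U : 'M[R]_(m, n)) (V : 'M[R]_(m, n')) : R :=
  (n%:R * (n%:R - 1))^-1 *
    (\sum_(i < n) \sum_(j < n | j != i)
       gaussian_kernel gamma (col i U) (col j U))
  - 2 / (n%:R * n'%:R) *
    (\sum_(i < n) \sum_(j < n') gaussian_kernel gamma (col i U) (col j V))
  + (n'%:R * (n'%:R - 1))^-1 *
    (\sum_(i < n') \sum_(j < n' | j != i)
       gaussian_kernel gamma (col i V) (col j V)).

(* The law N(0, sigma^2).  For sigma = 0 this is the point mass at 0, whereas
   normal_prob 0 0 is by convention the uniform law on [0, 1]. *)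
Definition centered_gaussian (R : realType) (sigma : R) (A : set R) : \bar R :=
  if sigma == 0 then \d_(0 : R) A else normal_prob 0 sigma A.

Definition has_centered_gaussian_law (R : realType) (d : measure_display)
    (Omega : measurableType d) (Pr : probability Omega R) (sigma : R)
    (Z : {RV Pr >-> R}) : Prop :=
  forall A : set R, measurable A ->
    distribution Pr Z A = centered_gaussian sigma A.

(* Main.v *)
(** Write [K] for the kernel matrix of [Yt, X], with blocks [W], [V], [K_XX].
    If [K] is singular the condition number is infinite.  Otherwise [K] and [W]
    are positive definite.  A best rank-k approximation [B] of [W] is the
    projection of [W] onto its column space and onto its row space; hence
    [A = B^+] satisfies [A W = A B] and [W A = B A], both symmetric.  So [A]
    commutes with [W^2], hence with [W], and [A] is symmetric with [A W A = A].
    Then [K_XX - V A V^T = L K L^T] for [L = [- V A, 1]] is positive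
    semidefinite with diagonal at most 1, so its entries are at most 1 in
    absolute value and its Frobenius norm is at most [nx], which is already
    below both additive terms of the bounds. *)
Require Import Defs.
From mathcomp Require Import all_boot all_order all_algebra.
From mathcomp Require Import all_classical all_reals all_analysis.
From mathcomp Require Import ring lra.
Import Order.TTheory GRing.Theory Num.Theory.
Import numFieldNormedType.Exports.
Set Implicit Arguments.
Unset Strict Implicit.
Unset Printing Implicit Defensive.
Local Open Scope classical_set_scope.
Local Open Scope ring_scope.

(** * Positive semidefinite matrices *)

Definition psdmx (R : realType) (n : nat) (M : 'M[R]_n) : Prop :=
  M^T = M /\ forall v : 'rV[R]_n, 0 <= (v *m M *m v^T) 0 0.

(** Cauchy-Schwarz, read off from Lagrange's identity. *)
Lemma sum_mul_le (R : realType) (n : nat) (x y : 'I_n -> R) :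
  (\sum_i x i * y i) ^+ 2 <= (\sum_i x i ^+ 2) * (\sum_i y i ^+ 2).
Proof.
suff e : \sum_i \sum_j (x i * y j - x j * y i) ^+ 2 =
    2 * ((\sum_i x i ^+ 2) * (\sum_i y i ^+ 2) - (\sum_i x i * y i) ^+ 2).
  have: 0 <= \sum_i \sum_j (x i * y j - x j * y i) ^+ 2.
    by apply: sumr_ge0 => i _; apply: sumr_ge0 => j _; rewrite sqr_ge0.
  by rewrite e pmulr_rge0// subr_ge0.
transitivity (\sum_i \sum_j (x i ^+ 2 * y j ^+ 2 + y i ^+ 2 * x j ^+ 2
     - 2 * (x i * y i) * (x j * y j))).
  by apply: eq_bigr => i _; apply: eq_bigr => j _; ring.
have E (f g : 'I_n -> R) :
    \sum_i \sum_j f i * g j = (\sum_i f i) * (\sum_i g i).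
  by rewrite mulr_suml; apply: eq_bigr => i _; rewrite mulr_sumr.
under eq_bigr => i _ do rewrite sumrB big_split /=.
by rewrite sumrB big_split /= !E -mulr_sumr; ring.
Qed.

Lemma quad_form1E (R : realType) (n : nat) (v : 'rV[R]_n) :
  (v *m v^T) 0 0 = \sum_j v 0 j ^+ 2.
Proof. by rewrite mxE; apply: eq_bigr => j _; rewrite mxE expr2. Qed.

Lemma quad_form1_ge0 (R : realType) (n : nat) (v : 'rV[R]_n) :
  0 <= (v *m v^T) 0 0.
Proof. by rewrite quad_form1E sumr_ge0// => j _; rewrite sqr_ge0. Qed.

Lemma quad_form1_eq0 (R : realType) (n : nat) (v : 'rV[R]_n) :
  (v *m v^T) 0 0 = 0 -> v = 0.
Proof.
rewrite quad_form1E => /eqP; rewrite psumr_eq0 => [|j _]; last exact: sqr_ge0.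
move=> /allP v0; apply/rowP => j; rewrite mxE; apply/eqP.
by rewrite -sqrf_eq0; apply: v0; rewrite mem_index_enum.
Qed.

(** If [w = v M] were nonzero, the form at [w - s v] would be [q - 2 s p] with [p = w w^T > 0],
    hence negative for large [s]. *)
Lemma psdmx_null (R : realType) (n : nat) (M : 'M[R]_n) (v : 'rV[R]_n) :
  psdmx M -> (v *m M *m v^T) 0 0 = 0 -> v *m M = 0.
Proof.
move=> [sM pM] v0; set w := v *m M.
apply: quad_form1_eq0; apply/eqP; rewrite eq_le quad_form1_ge0 andbT leNgt.
apply/negP; set p := (w *m w^T) 0 0 => p0.
set q := (w *m M *m w^T) 0 0.
(* This choice of [s] makes the form exactly [-1]. *)
have := pM (w - ((q + 1) / (2 * p)) *: v).
rewrite mulmxBl linearB /= linearZ /= mulmxBr !mulmxBl -!scalemxAl -!scalemxAr.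
rewrite -/w.
have -> : w *m M *m v^T = w *m w^T by rewrite /w trmx_mul sM !mulmxA.
move: v0; rewrite -/w => v0.
do 8 rewrite ?[(_ - _ : 'M[R]_1) _ _]mxE ?[(- _ : 'M[R]_1) _ _]mxE ?[(_ *: _ : 'M[R]_1) _ _]mxE.
rewrite v0 -/p -/q.
suff -> : q - (q + 1) / (2 * p) * p
   - ((q + 1) / (2 * p) * p - (q + 1) / (2 * p) * ((q + 1) / (2 * p) * 0)) = - 1.
  by rewrite oppr_ge0 lt_geF.
by field; rewrite gt_eqF.
Qed.

Lemma psdmx_congr (R : realType) (m n : nat) (L : 'M[R]_(m, n)) (M : 'M[R]_n) :
  psdmx M -> psdmx (L *m M *m L^T).
Proof.
move=> [sM pM]; split=> [|v]; first by rewrite !trmx_mul trmxK sM mulmxA.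
by have := pM (v *m L); rewrite trmx_mul !mulmxA.
Qed.

Lemma quad_form_delta (R : realType) (n : nat) (M : 'M[R]_n) (i j : 'I_n) :
  ((delta_mx 0 i : 'rV_n) *m M *m (delta_mx 0 j : 'rV_n)^T) 0 0 = M i j.
Proof. by rewrite trmx_delta -rowE -colE !mxE. Qed.

Lemma psdmx_diag_ge0 (R : realType) (n : nat) (M : 'M[R]_n) (i : 'I_n) :
  psdmx M -> 0 <= M i i.
Proof. by move=> [_ /(_ (delta_mx 0 i))]; rewrite quad_form_delta. Qed.

(** Testing the form at [e_i + e_j] and [e_i - e_j] bounds [2 |M i j|] by [M i i + M j j]. *)
Lemma psdmx_entry_le1 (R : realType) (n : nat) (M : 'M[R]_n) :
  psdmx M -> (forall i, M i i <= 1) -> forall i j, M i j ^+ 2 <= 1.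
Proof.
move=> [sM pM] M1 i j.
have e (s : R) : 0 <= M i i + s * M i j + (s * M i j + s * (s * M j j)).
  have := pM (delta_mx 0 i + s *: delta_mx 0 j).
  rewrite linearD /= linearZ /= !mulmxDl !mulmxDr -!scalemxAl -!scalemxAr.
  do 8 rewrite ?[(_ + _ : 'M[R]_1) _ _]mxE ?[(_ *: _ : 'M[R]_1) _ _]mxE.
  rewrite !quad_form_delta.
  by have -> : M j i = M i j by rewrite -[in RHS]sM mxE.
have := e 1; have := e (-1); have := M1 i; have := M1 j.
nra.
Qed.

(** * Matrix norms and the condition number *)

Lemma frobenius_norm_le (R : realType) (n : nat) (M : 'M[R]_n) :
  (forall i j, M i j ^+ 2 <= 1) -> frobenius_norm M <= n%:R.
Proof.
move=> M1; rewrite /frobenius_norm -[leRHS]ger0_norm ?ler0n// -sqrtr_sqr.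
apply: ler_wsqrtr.
apply: (@le_trans _ _ (\sum_(i < n) \sum_(j < n) 1)).
  by apply: ler_sum => i _; apply: ler_sum => j _.
by rewrite !sumr_const card_ord expr2 -natrM -mulrnA.
Qed.

(** An eigenvector [v] of [A^T A] for [a] satisfies [a |v|^2 = |v A^T|^2], and Cauchy-Schwarz
    applies to each entry of [v A^T]. *)
Lemma spectral_norm_le_frobenius (R : realType) (n : nat) (A : 'M[R]_n) :
  spectral_norm A <= frobenius_norm A.
Proof.
rewrite /spectral_norm /max_singular_value.
have [->|S0] := eqVneq (singular_values A) set0.
  by rewrite sup0 sqrtr_ge0.
apply: ge_sup; first exact/set0P.
move=> _ [a /eigenvalueP [v va v0] <-]; apply: ler_wsqrtr.
have vv0 : 0 < (v *m v^T) 0 0.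
  rewrite lt_neqAle quad_form1_ge0 andbT eq_sym.
  by apply: contra v0 => /eqP /quad_form1_eq0 ->.
have : (v *m (A^T *m A) *m v^T) 0 0 = a * (v *m v^T) 0 0.
  by rewrite va -scalemxAl mxE.
rewrite -(ler_pM2r vv0) => <-.
have -> : v *m (A^T *m A) *m v^T = v *m A^T *m (v *m A^T)^T.
  by rewrite trmx_mul trmxK !mulmxA.
rewrite !quad_form1E mulr_suml; apply: ler_sum => i _.
rewrite mulrC !mxE (le_trans _ (sum_mul_le _ _))//.
by under eq_bigr do rewrite mxE.
Qed.

Lemma singular_values_ge0 (R : realType) (n : nat) (A : 'M[R]_n) (a : R) :
  singular_values A a -> 0 <= a.
Proof. by move=> [b _ <-]; rewrite sqrtr_ge0. Qed.

Lemma cond_ge0 (R : realType) (n : nat) (A : 'M[R]_n) : (0 <= cond A)%E.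
Proof.
rewrite /cond; case: ifP => // _; rewrite lee_fin.
rewrite /max_singular_value /min_singular_value.
have [->|S0] := eqVneq (singular_values A) set0; first by rewrite sup0 mul0r.
apply: divr_ge0.
  (* Where no supremum exists, [sup] takes the default value [0]. *)
  have [hS|/sup_out ->//] := pselect (has_sup (singular_values A)).
  have [[a Sa] hub] := hS.
  exact: le_trans (singular_values_ge0 Sa) (ub_le_sup hub Sa).
by apply: lb_le_inf => [|a /singular_values_ge0]//; exact/set0P.
Qed.

(** * Positive semidefiniteness of the Gaussian kernel *)

(** Entrywise powers of a Gram matrix are positive semidefinite, so the partial sums [u N] of the
    exponential series give nonnegative forms, and so does their limit. *)
Lemma psdmx_expR_gram (R : realType) (m n : nat) (Z : 'M[R]_(m, n))
    (w : 'I_n -> R) :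
  0 <= \sum_i \sum_j w i * w j * expR (\sum_l Z l i * Z l j).
Proof.
pose g i j := \sum_l Z l i * Z l j.
pose u N := \sum_i \sum_j w i * w j * series (exp_coeff (g i j)) N.
have ucvg : u @ \oo --> \sum_i \sum_j w i * w j * expR (g i j).
  apply: cvg_big => [x|i _]; first exact: add_continuous.
  apply: cvg_big => [x|j _]; first exact: add_continuous.
  apply: cvgMl_tmp; exact: is_cvg_series_exp_coeff.
rewrite -(cvg_lim _ ucvg)//; apply: limr_ge; first exact: (cvgP _ ucvg).
apply: nearW => N; rewrite /u.
have -> : \sum_i \sum_j w i * w j * series (exp_coeff (g i j)) N =
    \sum_(0 <= t < N) (\sum_i \sum_j w i * w j * g i j ^+ t) / t`!%:R.
  under eq_bigr => i _ do under eq_bigr => j _ do rewrite /series /= mulr_sumr.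
  under eq_bigr => i _ do rewrite exchange_big /=.
  rewrite exchange_big /=; apply: eq_bigr => t _.
  rewrite mulr_suml; apply: eq_bigr => i _; rewrite mulr_suml.
  by apply: eq_bigr => j _; rewrite mulrA.
apply: sumr_ge0 => t _; rewrite divr_ge0//.
(* A power of a Gram matrix is the Gram matrix of tensor powers, indexed here by [f]. *)
have -> : \sum_i \sum_j w i * w j * g i j ^+ t =
    \sum_(f : {ffun 'I_t -> 'I_m}) (\sum_i w i * \prod_s Z (f s) i) ^+ 2.
  have gE i j : g i j ^+ t =
      \sum_(f : {ffun 'I_t -> 'I_m}) (\prod_s Z (f s) i) * \prod_s Z (f s) j.
    rewrite -[t in LHS]card_ord -prodr_const bigA_distr_bigA /=.
    by apply: eq_bigr => f _; rewrite big_split.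
  under eq_bigr => i _ do under eq_bigr => j _ do rewrite gE mulr_sumr.
  under eq_bigr => i _ do rewrite exchange_big /=.
  rewrite exchange_big /=; apply: eq_bigr => f _.
  rewrite expr2 mulr_suml; apply: eq_bigr => i _; rewrite mulr_sumr.
  by apply: eq_bigr => j _; rewrite mulrACA.
by apply: sumr_ge0 => f _; rewrite sqr_ge0.
Qed.

Lemma frobenius_norm_sqr_col (R : realType) (m : nat) (x : 'cV[R]_m) :
  frobenius_norm x ^+ 2 = \sum_l x l 0 ^+ 2.
Proof.
rewrite sqr_sqrtr.
  by apply: eq_bigr => l _; rewrite big_ord1.
by apply: sumr_ge0 => i _; apply: sumr_ge0 => j _; rewrite sqr_ge0.
Qed.

Lemma gaussian_kernelC (R : realType) (gamma : R) (m : nat) (x y : 'cV[R]_m) :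
  gaussian_kernel gamma x y = gaussian_kernel gamma y x.
Proof.
rewrite /gaussian_kernel !frobenius_norm_sqr_col; congr (expR (_ * _)).
by apply: eq_bigr => l _; rewrite !mxE -sqrrN opprB.
Qed.

Lemma gaussian_kernelxx (R : realType) (gamma : R) (m : nat) (x : 'cV[R]_m) :
  gaussian_kernel gamma x x = 1.
Proof.
rewrite /gaussian_kernel frobenius_norm_sqr_col subrr big1 ?mulr0 ?expR0//.
by move=> l _; rewrite mxE expr0n.
Qed.

Lemma tr_kernel_mx (R : realType) (gamma : R) (m n n' : nat)
    (U : 'M[R]_(m, n)) (V : 'M[R]_(m, n')) :
  (kernel_mx gamma U V)^T = kernel_mx gamma V U.
Proof. by apply/matrixP => i j; rewrite !mxE gaussian_kernelC. Qed.

(** The kernel factors as [exp(- gamma |x|^2) exp(- gamma |y|^2) exp(2 gamma <x, y>)]. The first two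
    factors are absorbed into the weights; scaling [Z] by [r] puts [2 gamma] into the Gram
    matrix. *)
Lemma psdmx_kernel (R : realType) (gamma : R) (m n : nat) (Z : 'M[R]_(m, n)) :
  0 <= gamma -> psdmx (kernel_mx gamma Z Z).
Proof.
move=> g0; split=> [|v]; first exact: tr_kernel_mx.
pose r := Num.sqrt (2 * gamma).
have r2 : r ^+ 2 = 2 * gamma by rewrite sqr_sqrtr ?mulr_ge0.
pose N i := \sum_l Z l i ^+ 2.
have kE i j : gaussian_kernel gamma (col i Z) (col j Z) =
    expR (- gamma * N i) * expR (- gamma * N j)
    * expR (\sum_l (r *: Z) l i * (r *: Z) l j).
  rewrite /gaussian_kernel frobenius_norm_sqr_col -!expRD; congr expR.
  rewrite -mulrDr /N -big_split /= !mulr_sumr -big_split /=.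
  apply: eq_bigr => l _; rewrite !mxE.
  transitivity (- gamma * (Z l i ^+ 2 + Z l j ^+ 2) + (2 * gamma) * Z l i * Z l j).
    by ring.
  by rewrite -r2; ring.
have := psdmx_expR_gram (r *: Z) (fun i => v 0 i * expR (- gamma * N i)).
congr (_ <= _); rewrite mxE exchange_big /=; apply: eq_bigr => j _.
rewrite !mxE mulr_suml; apply: eq_bigr => i _.
rewrite !mxE kE; ring.
Qed.

Lemma kernel_mx_row_mx (R : realType) (gamma : R) (m n n' : nat)
    (U : 'M[R]_(m, n)) (V : 'M[R]_(m, n')) :
  kernel_mx gamma (row_mx U V) (row_mx U V) =
  block_mx (kernel_mx gamma U U) (kernel_mx gamma V U)^T
           (kernel_mx gamma V U) (kernel_mx gamma V V).
Proof.
rewrite tr_kernel_mx -[LHS]submxK.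
by congr block_mx; apply/matrixP => i j; rewrite !mxE ?colKl ?colKr.
Qed.

(** * Best rank-k approximation and its Moore-Penrose inverse *)

Lemma frobenius_norm_sqrE (R : realType) (m n : nat) (M : 'M[R]_(m, n)) :
  frobenius_norm M ^+ 2 = \tr (M^T *m M).
Proof.
rewrite sqr_sqrtr.
  rewrite exchange_big /=; apply: eq_bigr => j _; rewrite mxE.
  by apply: eq_bigr => i _; rewrite mxE expr2.
by apply: sumr_ge0 => i _; apply: sumr_ge0 => j _; rewrite sqr_ge0.
Qed.

Lemma frobenius_norm_tr (R : realType) (m n : nat) (M : 'M[R]_(m, n)) :
  frobenius_norm M^T = frobenius_norm M.
Proof.
rewrite /frobenius_norm exchange_big /=; congr Num.sqrt.
by apply: eq_bigr => i _; apply: eq_bigr => j _; rewrite mxE.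
Qed.

Lemma frobenius_norm_eq0 (R : realType) (m n : nat) (M : 'M[R]_(m, n)) :
  frobenius_norm M = 0 -> M = 0.
Proof.
move=> /(congr1 (fun x => x ^+ 2)); rewrite expr0n sqr_sqrtr => [|]; last first.
  by apply: sumr_ge0 => i _; apply: sumr_ge0 => j _; rewrite sqr_ge0.
move=> /eqP; rewrite psumr_eq0 => [/allP M0|i _]; last first.
  by apply: sumr_ge0 => j _; rewrite sqr_ge0.
apply/matrixP => i j; rewrite mxE; apply/eqP.
have := M0 i (mem_index_enum _); rewrite psumr_eq0 => [|l _]; last exact: sqr_ge0.
by move=> /allP /(_ j (mem_index_enum _)); rewrite sqrf_eq0.
Qed.

(* Projecting [W] onto the column space of [B] does not raise the rank, so by
   Pythagoras it cannot move [B]. *)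
Lemma best_rank_approx_proj (R : realType) (m n k : nat)
    (W B : 'M[R]_(m, n)) (A : 'M[R]_(n, m)) :
  is_best_rank_approx k W B -> is_moore_penrose B A -> B *m A *m W = B.
Proof.
move=> [rB Bmin] [BAB _ sBA _].
set C := B *m A *m W; apply/subr0_eq/frobenius_norm_eq0.
set D := C - B.
have rC : (\rank C <= k)%N.
  by rewrite (leq_trans _ rB)// /C -mulmxA mxrankM_maxl.
(* The orthogonal projection [B *m A] fixes [D] and kills [W - C], so the two are orthogonal. *)
have PD : B *m A *m D = D by rewrite /D /C mulmxBr !mulmxA BAB.
have PE : B *m A *m (W - C) = 0.
  by rewrite /C mulmxBr !mulmxA BAB subrr.
have ED : (W - C)^T *m D = 0.
  by rewrite -PD mulmxA -{1}sBA -trmx_mul PE trmx0 mul0mx.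
have DE : D^T *m (W - C) = 0.
  by apply: trmx_inj; rewrite trmx_mul trmxK ED trmx0.
have pyth : frobenius_norm (W - B) ^+ 2 =
    frobenius_norm (W - C) ^+ 2 + frobenius_norm D ^+ 2.
  have -> : W - B = (W - C) + D by rewrite addrA subrK.
  move: (W - C) (D) ED DE => F G FG GF.
  rewrite !frobenius_norm_sqrE [(_ + G)^T]linearD /= mulmxDl !mulmxDr FG GF addr0 add0r.
  by rewrite mxtraceD.
have : frobenius_norm (W - B) ^+ 2 <= frobenius_norm (W - C) ^+ 2.
  by rewrite ler_sqr ?nnegrE ?sqrtr_ge0//; exact: Bmin.
rewrite pyth gerDl => D0; apply/eqP; rewrite -sqrf_eq0 eq_le D0.
by rewrite sqr_ge0.
Qed.

(** Transposition carries the column-space projection result over to the row space. *)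
Lemma best_rank_approx_tr (R : realType) (m n k : nat) (W B : 'M[R]_(m, n)) :
  is_best_rank_approx k W B -> is_best_rank_approx k W^T B^T.
Proof.
move=> [rB Bmin]; split=> [|C rC]; first by rewrite mxrank_tr.
rewrite -(trmxK C) -!linearB /= !frobenius_norm_tr; apply: Bmin.
by rewrite mxrank_tr.
Qed.

Lemma moore_penrose_tr (R : realType) (m n : nat) (B : 'M[R]_(m, n))
    (A : 'M[R]_(n, m)) : is_moore_penrose B A -> is_moore_penrose B^T A^T.
Proof.
move=> [BAB ABA sBA sAB]; split; rewrite -!trmx_mul ?trmxK.
- by rewrite mulmxA BAB.
- by rewrite mulmxA ABA.
- by rewrite sAB.
- by rewrite sBA.
Qed.

Lemma best_rank_approx_pinv (R : realType) (n k : nat) (W B A : 'M[R]_n) :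
  psdmx W -> W \in unitmx ->
  is_best_rank_approx k W B -> is_moore_penrose B A ->
  A^T = A /\ A *m W *m A = A.
Proof.
move=> psW uW bB mpB; have [sW _] := psW.
have [BAB ABA sBA sAB] := mpB.
have BAW := best_rank_approx_proj bB mpB.
have WAB : W *m A *m B = B.
  apply: trmx_inj; rewrite !trmx_mul mulmxA.
  exact: best_rank_approx_proj (best_rank_approx_tr bB) (moore_penrose_tr mpB).
have AB_AW : A *m B = A *m W by rewrite -{1}BAW !mulmxA ABA.
have BA_WA : B *m A = W *m A by rewrite -{1}WAB -!mulmxA [A *m (B *m A)]mulmxA ABA.
have AWA : A *m W *m A = A by rewrite -AB_AW ABA.
split=> //.
have sAW : (A *m W)^T = A *m W by rewrite -AB_AW.
have sWA : (W *m A)^T = W *m A by rewrite -BA_WA.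
have WAT : W *m A^T = A *m W by rewrite -sAW trmx_mul sW.
have ATW : A^T *m W = W *m A by rewrite -sWA trmx_mul sW.
pose D := A *m W - W *m A.
have sD : D^T = D by rewrite /D linearB /= sAW sWA.
(* [A] commutes with [W^2], whence this Sylvester equation for [D]. *)
have syl : W *m D + D *m W = 0.
  have WWA : A *m W *m W = W *m W *m A by rewrite -WAT -mulmxA ATW mulmxA.
  by rewrite /D mulmxBr mulmxBl !mulmxA WWA -[X in _ + X]opprB subrr.
(* Multiplying the Sylvester equation by [D] and taking traces gives [2 tr(D W D) = 0]. *)
have trDWD : \tr (D *m W *m D) = 0.
  have : \tr (D *m (W *m D + D *m W)) = 0 by rewrite syl mulmx0 mxtrace0.
  rewrite mulmxDr mxtraceD !mulmxA -[D *m D *m W]mulmxA.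
  by rewrite (mxtrace_mulC D (D *m W)); lra.
have psDWD : psdmx (D *m W *m D^T) by exact: psdmx_congr.
(* [D W D^T] is positive semidefinite of trace zero, so its diagonal vanishes; each diagonal entry
   is the form of [W] at a row of [D]. *)
have DW0 : D *m W = 0.
  apply/row_matrixP => i; rewrite row0 row_mul; apply: psdmx_null => //.
  have -> : (row i D *m W *m (row i D)^T) 0 0 = (D *m W *m D^T) i i.
    by rewrite -[RHS]quad_form_delta !rowE trmx_mul !mulmxA.
  have /eqP := trDWD; rewrite -[X in _ *m X]sD psumr_eq0 => [/allP|j _].
    by move=> /(_ i (mem_index_enum _)) /eqP.
  exact: psdmx_diag_ge0.
have /subr0_eq AW_WA : D = 0 by rewrite -(mulmxK uW D) DW0 mul0mx.
(* Now [A^T W = W A = A W], and [W] cancels. *)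
by rewrite -(mulmxK uW A^T) ATW -AW_WA mulmxK.
Qed.

(** * The Nyström residual *)

(** A null vector of [W], padded with zeros, has form value zero for the block matrix, so it lies in
    the kernel of that invertible matrix. *)
Lemma psdmx_unit_ulsub (R : realType) (m n : nat) (W : 'M[R]_m)
    (V : 'M[R]_(n, m)) (Z : 'M[R]_n) :
  psdmx (block_mx W V^T V Z) -> block_mx W V^T V Z \in unitmx ->
  psdmx W /\ W \in unitmx.
Proof.
move=> psK uK.
have qE (v : 'rV_m) : row_mx v 0 *m block_mx W V^T V Z *m (row_mx v 0)^T =
    v *m W *m v^T.
  by rewrite mul_row_block !mul0mx !addr0 tr_row_mx mul_row_col trmx0 mulmx0 addr0.
have psW : psdmx W.
  have [sK pK] := psK; split=> [|v]; last by rewrite -qE pK.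
  by move: sK; rewrite tr_block_mx => /eq_block_mx [].
split=> //; rewrite -row_free_unit -kermx_eq0; apply/eqP/row_matrixP => i.
set v := row i (kermx W); rewrite row0.
have vW : v *m W = 0 by apply/sub_kermxP; exact: row_sub.
have v0 : row_mx v 0 *m block_mx W V^T V Z = 0.
  by apply: psdmx_null => //; rewrite qE vW mul0mx mxE.
have : row_mx v 0 = 0 :> 'rV_(m + n) by rewrite -(mulmxK uK (row_mx v 0)) v0 mul0mx.
by rewrite -row_mx0 => /eq_row_mx [].
Qed.

(* The residual is the congruence of the block matrix by [[- V A, 1]]. *)
Lemma psdmx_nystrom_residual (R : realType) (m n : nat) (W A : 'M[R]_m)
    (V : 'M[R]_(n, m)) (Z : 'M[R]_n) :
  psdmx (block_mx W V^T V Z) -> A^T = A -> A *m W *m A = A ->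
  psdmx (Z - V *m A *m V^T).
Proof.
move=> psK sA AWA.
have := psdmx_congr (row_mx (- (V *m A)) 1%:M) psK; congr psdmx.
(* The first block of [[- V A, 1] K] is annihilated by [A], so only the second block, [Z - V A V^T],
   survives the congruence. *)
have VA0 : (- (V *m A) *m W + V) *m A = 0.
  by rewrite mulmxDl !mulNmx -!mulmxA [A *m (W *m A)]mulmxA AWA addNr.
rewrite mul_row_block !mul1mx tr_row_mx mul_row_col trmx1 mulmx1.
by rewrite linearN /= trmx_mul sA mulmxN mulmxA VA0 mul0mx oppr0 add0r mulNmx addrC.
Qed.

Lemma nystrom_frobenius_le (R : realType) (gamma : R) (hgamma : 0 <= gamma)
    (m nx ny k : nat) (X : 'M[R]_(m, nx)) (U : 'M[R]_(m, ny))
    (Wk Wkdag : 'M[R]_ny) :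
  kernel_mx gamma (row_mx U X) (row_mx U X) \in unitmx ->
  is_best_rank_approx k (kernel_mx gamma U U) Wk ->
  is_moore_penrose Wk Wkdag ->
  frobenius_norm (kernel_mx gamma X U *m Wkdag *m (kernel_mx gamma X U)^T
                  - kernel_mx gamma X X) <= nx%:R.
Proof.
have := psdmx_kernel (row_mx U X) hgamma; rewrite kernel_mx_row_mx.
set W := kernel_mx gamma U U; set V := kernel_mx gamma X U => psK uK bW mpW.
have [psW uW] := psdmx_unit_ulsub psK uK.
have [sA AWA] := best_rank_approx_pinv psW uW bW mpW.
have psD := psdmx_nystrom_residual psK sA AWA.
(* By [A W A = A] this is a congruence of [W]; subtracting it can only lower the unit diagonal of
   [K_XX]. *)
have H_ge0 i : 0 <= (V *m Wkdag *m V^T) i i.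
  have -> : V *m Wkdag *m V^T = (V *m Wkdag) *m W *m (V *m Wkdag)^T.
    by rewrite trmx_mul sA -!mulmxA [Wkdag *m (W *m _)]mulmxA
      [Wkdag *m W *m _]mulmxA AWA.
  exact/psdmx_diag_ge0/psdmx_congr.
have D_le1 i : (kernel_mx gamma X X - V *m Wkdag *m V^T) i i <= 1.
  have := H_ge0 i; set H := V *m Wkdag *m V^T => Hi.
  by rewrite mxE [(- H) _ _]mxE mxE gaussian_kernelxx gerBl.
apply: frobenius_norm_le => i j; have := psdmx_entry_le1 psD D_le1 i j.
by rewrite -opprB [(- _ : 'M[R]_nx) i j]mxE sqrrN.
Qed.

Theorem theorem5 (R : realType) (gamma : R) (hgamma : 0 < gamma)
    (m P : nat) (np : 'I_P -> nat) (Xp : forall p : 'I_P, 'M[R]_(m, np p))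
    (nx : nat) (hnx : nx = (\sum_(p < P) np p)%N) (hnx2 : (2 <= nx)%N)
    (X : 'M[R]_(m, nx))
    (hX : X = castmx (erefl m, esym hnx) (\mxrow_(p < P) Xp p))
    (ny : nat) (hny2 : (2 <= ny)%N) (Y : 'M[R]_(m, ny))
    (d : measure_display) (Omega : measurableType d)
    (Pr : probability Omega R) (sigma : R) (hsigma : 0 <= sigma)
    (E : 'I_m -> 'I_ny -> {RV Pr >-> R})
    (hE : forall i j, has_centered_gaussian_law sigma (E i j))
    (k : nat) (hk : (1 <= k <= ny)%N)
    (omega : Omega) :
  let Yt : 'M[R]_(m, ny) := Y + \matrix_(i < m, j < ny) E i j omega in
  let Xa : 'M[R]_(m, ny + nx) := row_mx Yt X in
  let W : 'M[R]_ny := kernel_mx gamma Yt Yt in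
  forall Wk Wkdag : 'M[R]_ny,
    is_best_rank_approx k W Wk ->
    is_moore_penrose Wk Wkdag ->
  let KXY : 'M[R]_(nx, ny) := kernel_mx gamma X Yt in
  let H : 'M[R]_nx := KXY *m Wkdag *m KXY^T in
  let KXX : 'M[R]_nx := kernel_mx gamma X X in
  let condK : \bar R := cond (kernel_mx gamma Xa Xa) in
  let c : R := `|MMD gamma X Yt| / (nx%:R + ny%:R) + 1 in
  ((spectral_norm (H - KXX))%:E
     <= condK * c%:E + (2 * nx%:R)%:E)%E
  /\
  ((frobenius_norm (H - KXX))%:E
     <= (Num.sqrt (nx%:R + ny%:R - k%:R))%:E * condK * c%:E
        + (2 * (k%:R `^ (1 / 4)) * nx%:R
             * Num.sqrt (1 + ny%:R / nx%:R))%:E)%E.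
Proof.
move=> Yt Xa W Wk Wkdag bW mpW KXY H KXX condK c.
have c_gt0 : 0 < c by rewrite ltr_wpDl// divr_ge0.
have nx_gt0 : 0 < nx%:R :> R by rewrite ltr0n (leq_trans _ hnx2).
have /andP[k_ge1 k_le] := hk.
have kny : k%:R <= ny%:R :> R by rewrite ler_nat.
have s_gt0 : 0 < Num.sqrt (nx%:R + ny%:R - k%:R : R) by rewrite sqrtr_gt0; lra.
(* In the singular case both right-hand sides are [+oo]: [c] and the square root are strictly
   positive, which excludes the product [0 * +oo = 0]. *)
have [uK|nuK] := boolP (kernel_mx gamma Xa Xa \in unitmx); last first.
  have -> : condK = +oo%E by rewrite /condK /cond (negbTE nuK).
  by rewrite gt0_muley ?lte_fin// gt0_mulye ?lte_fin// !addye// !leey.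
have F_le : frobenius_norm (H - KXX) <= nx%:R.
  exact: (nystrom_frobenius_le (ltW hgamma) (U := Yt) uK bW mpW).
have condK_ge0 : (0 <= condK)%E := cond_ge0 _.
split.
  apply: (@le_trans _ _ (2 * nx%:R)%:E).
    by rewrite lee_fin (le_trans (spectral_norm_le_frobenius _))//; lra.
  by rewrite leeDr// mule_ge0// lee_fin ltW.
set b := 2 * (k%:R `^ (1 / 4)) * nx%:R * Num.sqrt (1 + ny%:R / nx%:R).
(* The nonnegative condition-number term is dropped; [b] alone dominates [nx], as its fourth root
   (with [k >= 1]) and its square root are at least [1]. *)
apply: (@le_trans _ _ b%:E); last first.
  by rewrite leeDr// !mule_ge0// lee_fin ltW.
have k4_ge1 : 1 <= k%:R `^ (1 / 4) :> R.
  apply: (@le_trans _ _ (1 `^ (1 / 4))); first by rewrite powR1.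
  by rewrite ge0_ler_powR ?nnegrE ?ler1n ?divr_ge0.
have r_ge1 : 1 <= Num.sqrt (1 + ny%:R / nx%:R) :> R.
  by rewrite -[leLHS]sqrtr1 ler_wsqrtr// lerDl divr_ge0.
rewrite lee_fin (le_trans F_le)// /b.
rewrite -[leLHS]mulr1 ler_pM// -[leLHS]mul1r ler_pM//.
by rewrite mulr_ege1// ler1n.
Qed.
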